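(* Let $M,m$ be coprime positive integers and $m_2\in\mathbf Z$ with $0\le m_2\le m-1$. Let $\Omega^{(\mathrm I)}=\{(k_1,k_2)\in(\mathbf Z_{\ge0})^2:\ 2k_1+k_2\le M-2\}$ and $\Omega^{(\mathrm{III})}=\{(k_1,k_2)\in\mathbf Z_{\ge 0}\times\mathbf Z_{\ge1}:\ 2k_1+k_2\le M-2\}$. Write $\ddot H(\heartsuit)=\overset{N=4}{\ddot H}(\Lambda^{(M)(m,m_2)(\heartsuit)}_{k_1,k_2})$ for $\heartsuit\in\{\mathrm I,\mathrm{III}\}$, where $(k_1,k_2)\in\Omega^{(\heartsuit)}$. Then, as meromorphic functions of $(\tau,z)$, $\mathrm{Im}\,\tau>0$: 1) (I) $\mathrm{ch}^{(+)}_{\ddot H(\mathrm I)}(\tau,z)=i(-1)^{m_2}\,\Psi^{[M,m,-m_2;\frac12]}_{k_1+\frac12,\,k_1+k_2+\frac12;\,\frac12}(\tau,z,-z,0)\cdot\dfrac{\vartheta_{00}(\tau,z)^2}{\eta(\tau)^3\vartheta_{11}(\tau,2z)}$; (III) $\mathrm{ch}^{(+)}_{\ddot H(\mathrm{III})}(\tau,z)=i(-1)^{m_2}\,\Psi^{[M,m,-m_2;\frac12]}_{k_1+\frac12,\,k_1+k_2+\frac12;\,\frac12}(\tau,-z,z,0)\cdot\dfrac{\vartheta_{00}(\tau,z)^2}{\eta(\tau)^3\vartheta_{11}(\tau,2z)}$. 2) (I) $\mathrm{ch}^{(-)}_{\ddot H(\mathrm I)}(\tau,z)=i\,\Psi^{[M,m,-m_2;0]}_{k_1+\frac12,\,k_1+k_2+\frac12;\,\frac12}(\tau,z,-z,0)\cdot\dfrac{\vartheta_{01}(\tau,z)^2}{\eta(\tau)^3\vartheta_{11}(\tau,2z)}$;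 (III) $\mathrm{ch}^{(-)}_{\ddot H(\mathrm{III})}(\tau,z)=i\,\Psi^{[M,m,-m_2;0]}_{k_1+\frac12,\,k_1+k_2+\frac12;\,\frac12}(\tau,-z,z,0)\cdot\dfrac{\vartheta_{01}(\tau,z)^2}{\eta(\tau)^3\vartheta_{11}(\tau,2z)}$. $1)^{\mathrm{tw}}$ (I) $\mathrm{ch}^{(+)\mathrm{tw}}_{\ddot H(\mathrm I)}(\tau,z)=i(-1)^{m_2}\,\Psi^{[M,m,-m_2;\frac12]}_{k_1+1,\,k_1+k_2;\,0}(\tau,-z,z,0)\cdot\dfrac{\vartheta_{10}(\tau,z)^2}{\eta(\tau)^3\vartheta_{11}(\tau,2z)}$; (III) $\mathrm{ch}^{(+)\mathrm{tw}}_{\ddot H(\mathrm{III})}(\tau,z)=i(-1)^{m_2}\,\Psi^{[M,m,-m_2;\frac12]}_{k_1,\,k_1+k_2+1;\,0}(\tau,z,-z,0)\cdot\dfrac{\vartheta_{10}(\tau,z)^2}{\eta(\tau)^3\vartheta_{11}(\tau,2z)}$. $2)^{\mathrm{tw}}$ (I) $\mathrm{ch}^{(-)\mathrm{tw}}_{\ddot H(\mathrm I)}(\tau,z)=i\,\Psi^{[M,m,-m_2;0]}_{k_1+1,\,k_1+k_2;\,0}(\tau,-z,z,0)\cdot\dfrac{\vartheta_{11}(\tau,z)^2}{\eta(\tau)^3\vartheta_{11}(\tau,2z)}$; (III) $\mathrm{ch}^{(-)\mathrm{tw}}_{\ddot H(\mathrm{III})}(\tau,z)=i\,\Psi^{[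M,m,-m_2;0]}_{k_1,\,k_1+k_2+1;\,0}(\tau,z,-z,0)\cdot\dfrac{\vartheta_{11}(\tau,z)^2}{\eta(\tau)^3\vartheta_{11}(\tau,2z)}$.
   Context: Functions. $q=e^{2\pi i\tau}$. For $m\in\frac12\mathbf Z_{>0}$, $s\in\frac12\mathbf Z$: $\Phi^{[m,s]}_1(\tau,z_1,z_2,t)=e^{-2\pi imt}\sum_{j\in\mathbf Z}\frac{e^{2\pi imj(z_1+z_2)+2\pi isz_1}q^{mj^2+sj}}{1-e^{2\pi iz_1}q^j}$, $\Phi^{[m,s]}_2(\tau,z_1,z_2,t)=e^{-2\pi imt}\sum_{j\in\mathbf Z}\frac{e^{-2\pi imj(z_1+z_2)-2\pi isz_2}q^{mj^2+sj}}{1-e^{-2\pi iz_2}q^j}$, $\Phi^{[m,s]}=\Phi^{[m,s]}_1-\Phi^{[m,s]}_2$. For $\varepsilon,\varepsilon'\in\{0,\frac12\}$ and $j,k\in\varepsilon'+\mathbf Z$: $\Psi^{[M,m,s;\varepsilon]}_{j,k;\varepsilon'}(\tau,z_1,z_2,t)=q^{\frac mMjk}e^{\frac{2\pi im}{M}(kz_1+jz_2)}\Phi^{[m,s]}(M\tau,z_1+j\tau+\varepsilon,z_2+k\tau-\varepsilon,\frac tM)$. $\vartheta_{ab}(\tau,z)=\sum_{n\in\mathbf Z}e^{\pi i(n+\frac a2)^2\tau+2\pi i(n+\frac a2)(z+\frac b2)}$ (Mumford), $\eta(\tau)=q^{1/24}\prod_{n\ge1}(1-q^n)$. Affine superalgebra.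 $\widehat A(1,1)$ is the affine Lie superalgebra of $sl(2|2)/\mathbf CI$ with simple roots $\alpha_0,\alpha_2$ (even), $\alpha_1,\alpha_3$ (odd), and $(\alpha_0|\alpha_0)=2$, $(\alpha_2|\alpha_2)=-2$, $(\alpha_1|\alpha_1)=(\alpha_3|\alpha_3)=(\alpha_1|\alpha_3)=(\alpha_0|\alpha_2)=0$, $(\alpha_0|\alpha_1)=(\alpha_0|\alpha_3)=-1$, $(\alpha_1|\alpha_2)=(\alpha_2|\alpha_3)=1$ (so $\alpha_1,\alpha_3$ coincide as functions on the Cartan subalgebra). $\delta=\sum_{i=0}^3\alpha_i$, $\theta=\alpha_1+\alpha_2+\alpha_3$, $(\Lambda_0|\alpha_j)=\delta_{j,0}$, $(\Lambda_0|\Lambda_0)=0$, $\rho=-\frac12(\alpha_1+\alpha_3)$, dual Coxeter number $0$. The Cartan subalgebra is identified with its dual via $(\cdot|\cdot)$, with coordinates $(\tau,z_1,z_2,t)=2\pi i(-\tau\Lambda_0+z+t\delta)$, $z=-\frac{z_1-z_2}2(\alpha_1+\alpha_3)-z_1\alpha_2$; thus $e^{-\alpha_1}=e^{-\alpha_3}=e^{2\pi iz_1}$, $e^{-\alpha_2}=e^{-2\pi i(z_1+z_2)}$, $e^{\Lambda_0}=e^{2\pi it}$, $e^{-\delta}=q$. Put $t_\alpha(\lambda)=\lambda+(\lambda|\delta)\alpha-\{\frac{(\alpha|\alpha)}2(\lambda|\delta)+(\lambda|\alpha)\}\delta$, $r_\theta(\lambda)=\lambda-(\lambda|\theta)\theta$,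 $r_{\alpha_2}(\lambda)=\lambda+(\lambda|\alpha_2)\alpha_2$, and $w.\lambda=w(\lambda+\rho)-\rho$. Characters of modules. All characters are normalized (super)characters ($+$: character, $-$: supercharacter), $\widehat R^{(\pm)}$ is the (super)denominator, and ''numerator'' means the product $\widehat R^{(\pm)}\mathrm{ch}^{(\pm)}$. They are given by the following formulas. For $0\le m_2\le m$ let $\Lambda^{(m,m_2)}=m\Lambda_0+\frac{m_2}2(\alpha_1+\alpha_3)$ and $F^{(\pm)}=\sum_{j\in\mathbf Z}t_{j\theta}\Big(\frac{e^{\Lambda^{(m,m_2)}+\rho}}{(1\pm e^{-\alpha_1})(1\pm e^{-\alpha_3})}\Big)$; then $\widehat R^{(\pm)}\mathrm{ch}^{(\pm)}_{L(\Lambda^{(m,m_2)})}=F^{(\pm)}-r_\theta F^{(\pm)}$. For $\beta=\beta[b_1,b_2]:=-\frac{b_1-b_2}2(\alpha_1+\alpha_3)-b_1\alpha_2$ and a type $\heartsuit$ put: (I) $\overline y=1$, $\beta=\beta[k_1,-(k_1+k_2)]$; (III) $\overline y=r_{\alpha_2}$, $\beta=\beta[k_1+k_2,-k_1]$. The principal admissible weight is $\Lambda^{(M)(m,m_2)(\heartsuit)}_{k_1,k_2}=(t_\beta\overline y).(\Lambda^{(m,m_2)}-(M-1)\frac mM\Lambda_0)$ and its irreducible highest weight module has $[\widehat R^{(\pm)}\mathrm{ch}^{(\pm)}_{L(\Lambda^{(M)(m,m_2)(\heartsuit)}_{k_1,k_2})}](\tau,z,t)=[\widehat R^{(\pm)}\mathrm{ch}^{(\pm)}_{L(\Lambda^{(m,m_2)})}]\big(M\tau,\overline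 y^{-1}(z+\tau\beta),\frac1M(t+(z|\beta)+\frac{\tau|\beta|^2}2)\big)$. Twisted functions are $f^{\mathrm{tw}}(h)=f(w_0h)$ with $w_0=r_{\alpha_2}t_{-\frac12\alpha_2}$, i.e. $w_0(\tau,z_1,z_2,t)=(\tau,-z_2+\frac\tau2,-z_1+\frac\tau2,t+\frac{z_1+z_2}2-\frac\tau4)$. For $0\le m_2\le m-1$, $\ddot L(\Lambda^{(M)(m,m_2)(\heartsuit)}_{k_1,k_2})=L(\Lambda^{(M)(m,m_2)(\heartsuit)}_{k_1,k_2})\oplus L(\Lambda^{(M)(m,m_2+1)(\heartsuit)}_{k_1,k_2})$, with $\mathrm{ch}^{(\pm)}_{\ddot L}=\mathrm{ch}^{(\pm)}_{L(\Lambda^{(M)(m,m_2)(\heartsuit)}_{k_1,k_2})}\pm\mathrm{ch}^{(\pm)}_{L(\Lambda^{(M)(m,m_2+1)(\heartsuit)}_{k_1,k_2})}$ and the same for twisted characters. N=4 characters. $\overset{N=4}{\ddot H}(\Lambda)$ is the quantum Hamiltonian reduction of $\ddot L(\Lambda)$ for $(x=\frac12\theta,f=e_{-\theta})$, a module of the N=4 superconformal algebra of central charge $-6(\frac mM+1)$. Its characters are given by $[\overset{N=4}R{}^{(\pm)}\mathrm{ch}^{(\pm)}_{\ddot H}](\tau,z)=[\widehat R^{(\pm)}\mathrm{ch}^{(\pm)}_{\ddot L}](\tau,z+\frac\tau2,z-\frac\tau2,\frac\tau4)$, and likewise with ''tw'' throughout, where the N=4 denominators are $\overset{N=4}R{}^{(+)}=-i\frac{\eta(\tau)^3\vartheta_{11}(\tau,2z)}{\vartheta_{00}(\tau,z)^2}$,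 $\overset{N=4}R{}^{(-)}=i\frac{\eta(\tau)^3\vartheta_{11}(\tau,2z)}{\vartheta_{01}(\tau,z)^2}$, $\overset{N=4}R{}^{(+)\mathrm{tw}}=-i\frac{\eta(\tau)^3\vartheta_{11}(\tau,2z)}{\vartheta_{10}(\tau,z)^2}$, $\overset{N=4}R{}^{(-)\mathrm{tw}}=i\frac{\eta(\tau)^3\vartheta_{11}(\tau,2z)}{\vartheta_{11}(\tau,z)^2}$. *)

(* Defs.v *)
From Stdlib Require Import Reals ZArith Lra Lia Znumtheory.
From Coquelicot Require Import Coquelicot.

Open Scope C_scope.

Coercion IZR : Z >-> R.

Definition cexp (w : C) : C :=
  ((exp (Re w) * cos (Im w))%R, (exp (Re w) * sin (Im w))%R).

(* [e2pi w] is exp(2 pi i w); in particular q^x = e2pi (x * tau). *)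
Definition e2pi (w : C) : C := cexp (2 * PI * Ci * w).
Definition qpow (tau x : C) : C := e2pi (x * tau).

Definition Clim (u : nat -> C) : C :=
  (real (Lim_seq (fun n => Re (u n))), real (Lim_seq (fun n => Im (u n)))).

Definition Cseries (u : nat -> C) : C :=
  (Series (fun n => Re (u n)), Series (fun n => Im (u n))).

(* Sum over all integers.  All the bilateral series below converge absolutely
   away from the zeros of the denominators of their terms, so the order of
   summation is immaterial. *)
Definition Zseries (u : Z -> C) : C :=
  Cseries (fun n => u (Z.of_nat n)) + Cseries (fun n => u (- Z.of_nat (S n))%Z).

Fixpoint Cprod (u : nat -> C) (n : nat) : C :=
  match n with O => 1 | S n' => Cprod u n' * u n' end.

Definition theta (a b : R) (tau z : C) : C :=
  Zseries (fun n : Z =>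
    cexp (PI * Ci * (n + a / 2) ^ 2 * tau
          + 2 * PI * Ci * (n + a / 2) * (z + b / 2))).

Definition eta (tau : C) : C :=
  qpow tau (1 / 24) * Clim (Cprod (fun n => 1 - qpow tau (INR (S n)))).

Definition Phi1 (m s : R) (tau z1 z2 t : C) : C :=
  e2pi (- (m * t)) *
  Zseries (fun j : Z =>
    e2pi (m * j * (z1 + z2) + s * z1) * qpow tau (m * j ^ 2 + s * j)
    / (1 - e2pi z1 * qpow tau j)).

Definition Phi2 (m s : R) (tau z1 z2 t : C) : C :=
  e2pi (- (m * t)) *
  Zseries (fun j : Z =>
    e2pi (- (m * j * (z1 + z2)) - s * z2) * qpow tau (m * j ^ 2 + s * j)
    / (1 - e2pi (- z2) * qpow tau j)).

Definition Phi (m s : R) (tau z1 z2 t : C) : C :=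
  Phi1 m s tau z1 z2 t - Phi2 m s tau z1 z2 t.

(* Psi^{[M,m,s;eps]}_{j,k;eps'}; the index eps' in {0,1/2} only records the
   common class of j and k modulo Z, and does not enter the formula. *)
Definition Psi (M : Z) (m s eps j k : R) (tau z1 z2 t : C) : C :=
  qpow tau (m / M * j * k) * e2pi (m / M * (k * z1 + j * z2)) *
  Phi m s (M * tau) (z1 + j * tau + eps) (z2 + k * tau - eps) (t / M).

(* [(l, a0, a1, a2)] stands for l Lambda_0 + a0 alpha_0 + a1 alpha_1 + a2 alpha_2;
   addition and scaling are those of Coquelicot's product modules.  The Cartan
   subalgebra is identified with this space by the bilinear form. *)
Definition weight : Type := (C * C * C * C)%type.

Definition form (x y : weight) : C :=
  let '(l, a0, a1, a2) := x in
  let '(l', a0', a1', a2') := y in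
  l * a0' + a0 * l'
  + 2 * (a0 * a0') - (a0 * a1' + a1 * a0') + (a1 * a2' + a2 * a1')
  - 2 * (a2 * a2').

Definition Lambda0 : weight := (RtoC 1, RtoC 0, RtoC 0, RtoC 0).
Definition alpha0 : weight := (RtoC 0, RtoC 1, RtoC 0, RtoC 0).
Definition alpha1 : weight := (RtoC 0, RtoC 0, RtoC 1, RtoC 0).
Definition alpha2 : weight := (RtoC 0, RtoC 0, RtoC 0, RtoC 1).
(* alpha_1 and alpha_3 coincide as functions on the Cartan subalgebra. *)
Definition alpha3 : weight := alpha1.

Definition wadd (x y : weight) : weight := plus x y.
Definition wsub (x y : weight) : weight := minus x y.
Definition wscal (a : C) (x : weight) : weight := scal a x.

Declare Scope weight_scope.
Delimit Scope weight_scope with W.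
Bind Scope weight_scope with weight.
Infix "+" := wadd : weight_scope.
Infix "-" := wsub : weight_scope.
Notation "a *: x" := (wscal a%C x) (at level 40) : weight_scope.

Definition delta : weight := (alpha0 + alpha1 + alpha2 + alpha3)%W.
Definition theta_root : weight := (alpha1 + alpha2 + alpha3)%W.
Definition rho : weight := ((- (1 / 2)) *: (alpha1 + alpha3))%W.

Definition transl (a x : weight) : weight :=
  (x + form x delta *: a
   - (form a a / 2 * form x delta + form x a) *: delta)%W.
Definition r_theta (x : weight) : weight :=
  (x - form x theta_root *: theta_root)%W.
Definition r_alpha2 (x : weight) : weight := (x + form x alpha2 *: alpha2)%W.
Definition dot (w : weight -> weight) (x : weight) : weight :=
  (w (x + rho) - rho)%W.

(* beta[b1,b2]; also the finite part z of a point with coordinates z1, z2. *)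
Definition beta (b1 b2 : C) : weight :=
  ((- ((b1 - b2) / 2)) *: (alpha1 + alpha3) - b1 *: alpha2)%W.

(* The point (tau, z, t) = 2 pi i (- tau Lambda_0 + z + t delta). *)
Definition point (tau : C) (z : weight) (t : C) : weight :=
  ((2 * PI * Ci) *: ((- tau) *: Lambda0 + z + t *: delta))%W.

(* The function e^x on the Cartan subalgebra. *)
Definition wexp (x h : weight) : C := cexp (form x h).

(* [SPlus]: characters; [SMinus]: supercharacters. *)
Inductive sign : Set := SPlus | SMinus.
Definition sgn (s : sign) : C := match s with SPlus => 1 | SMinus => - (1) end.

Inductive heart : Set := TypeI | TypeIII.

Definition Lambda (m m2 : Z) : weight :=
  (m *: Lambda0 + (m2 / 2) *: (alpha1 + alpha3))%W.

(* w (e^{Lambda+rho} / ((1 +- e^{-alpha_1})(1 +- e^{-alpha_3}))), where w acts on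
   functions by w e^x = e^{w x}. *)
Definition F_term (s : sign) (m m2 : Z) (w : weight -> weight) (h : weight) : C :=
  wexp (w (Lambda m m2 + rho)%W) h
  / ((1 + sgn s * wexp (w ((- (1)) *: alpha1)%W) h)
     * (1 + sgn s * wexp (w ((- (1)) *: alpha3)%W) h)).

(* w F, with F the sum of F_term over the translations t_{j theta}. *)
Definition F_sum (s : sign) (m m2 : Z) (w : weight -> weight) (h : weight) : C :=
  Zseries (fun j : Z =>
    F_term s m m2 (fun x => w (transl (j *: theta_root)%W x)) h).

(* R^ ch of L(Lambda^{(m,m2)}). *)
Definition num_L (s : sign) (m m2 : Z) (h : weight) : C :=
  F_sum s m m2 (fun x => x) h - F_sum s m m2 r_theta h.

(* ybar is an involution, hence its own inverse. *)
Definition ybar (ty : heart) : weight -> weight :=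
  match ty with TypeI => fun x => x | TypeIII => r_alpha2 end.

Definition beta_adm (ty : heart) (k1 k2 : Z) : weight :=
  match ty with
  | TypeI => beta k1 (- (k1 + k2))
  | TypeIII => beta (k1 + k2) (- k1)
  end.

Definition Omega (ty : heart) (M k1 k2 : Z) : Prop :=
  match ty with
  | TypeI => (0 <= k1 /\ 0 <= k2 /\ 2 * k1 + k2 <= M - 2)%Z
  | TypeIII => (0 <= k1 /\ 1 <= k2 /\ 2 * k1 + k2 <= M - 2)%Z
  end.

(* The principal admissible weight Lambda^{(M)(m,m2)(ty)}_{k1,k2}. *)
Definition adm_weight (M m m2 : Z) (ty : heart) (k1 k2 : Z) : weight :=
  dot (fun x => transl (beta_adm ty k1 k2) (ybar ty x))
      (Lambda m m2 - ((M - 1) * (m / M)) *: Lambda0)%W.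

(* R^ ch of the irreducible module L(Lambda) of highest weight
   Lambda = adm_weight M m m2 ty k1 k2, in the coordinates (tau,z1,z2,t).  It is
   written as a function of the parameters, which Lambda determines:
   see adm_weight_inj. *)
Definition num_adm (s : sign) (M m m2 : Z) (ty : heart) (k1 k2 : Z)
    (tau z1 z2 t : C) : C :=
  let z := beta z1 z2 in
  let b := beta_adm ty k1 k2 in
  num_L s m m2
    (point (M * tau) (ybar ty (z + tau *: b)%W)
       (1 / M * (t + form z b + tau * form b b / 2))).

(* R^ ch of L..(Lambda), the sum of the modules with parameters m2 and m2+1. *)
Definition num_ddotL (s : sign) (M m m2 : Z) (ty : heart) (k1 k2 : Z)
    (tau z1 z2 t : C) : C :=
  num_adm s M m m2 ty k1 k2 tau z1 z2 t
  + sgn s * num_adm s M m (m2 + 1) ty k1 k2 tau z1 z2 t.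

Inductive sector : Set := Untwisted | Twisted.

(* f^tw (h) = f (w0 h), in coordinates; see w0_coordinates. *)
Definition twist (f : C -> C -> C -> C -> C) (tau z1 z2 t : C) : C :=
  f tau (- z2 + tau / 2) (- z1 + tau / 2) (t + (z1 + z2) / 2 - tau / 4).

Definition num_ddotL_sector (s : sign) (sec : sector) (M m m2 : Z) (ty : heart)
    (k1 k2 : Z) : C -> C -> C -> C -> C :=
  match sec with
  | Untwisted => num_ddotL s M m m2 ty k1 k2
  | Twisted => twist (num_ddotL s M m m2 ty k1 k2)
  end.

Definition N4_denominator (s : sign) (sec : sector) (tau z : C) : C :=
  match s, sec with
  | SPlus, Untwisted =>
      - Ci * (eta tau ^ 3 * theta 1 1 tau (2 * z) / theta 0 0 tau z ^ 2)
  | SMinus, Untwisted =>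
      Ci * (eta tau ^ 3 * theta 1 1 tau (2 * z) / theta 0 1 tau z ^ 2)
  | SPlus, Twisted =>
      - Ci * (eta tau ^ 3 * theta 1 1 tau (2 * z) / theta 1 0 tau z ^ 2)
  | SMinus, Twisted =>
      Ci * (eta tau ^ 3 * theta 1 1 tau (2 * z) / theta 1 1 tau z ^ 2)
  end.

(* The (super)character of H..(Lambda), the quantum Hamiltonian reduction of
   L..(Lambda), Lambda = adm_weight M m m2 ty k1 k2. *)
Definition N4_ch (s : sign) (sec : sector) (M m m2 : Z) (ty : heart) (k1 k2 : Z)
    (tau z : C) : C :=
  num_ddotL_sector s sec M m m2 ty k1 k2 tau (z + tau / 2) (z - tau / 2) (tau / 4)
  / N4_denominator s sec tau z.

(* Equality of meromorphic functions of (tau, z), Im tau > 0, all of whose poles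
   lie on 2z in Z + Z tau.  For the functions considered here this nowhere dense
   set contains the zeros of the denominators of all the terms of the series
   involved, and the zeros and poles of the N=4 denominators. *)
Definition mero_eq (f g : C -> C -> C) : Prop :=
  forall tau z : C, (0 < Im tau)%R ->
    (forall a b : Z, 2 * z <> a + b * tau) ->
    f tau z = g tau z.

Lemma weight_eq (x y : weight) :
  fst (fst (fst x)) = fst (fst (fst y)) -> snd (fst (fst x)) = snd (fst (fst y)) ->
  snd (fst x) = snd (fst y) -> snd x = snd y -> x = y.
Proof.
destruct x as [[[l a] b] c], y as [[[l' a'] b'] c']; simpl; intros; subst; reflexivity.
Qed.

Ltac weight_simpl :=
  unfold dot, ybar, beta_adm, r_alpha2, r_theta, transl, point, beta, Lambda,
    rho, theta_root, delta, alpha3, form, wadd, wsub, wscal, minus, plus, opp,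
    scal, Lambda0, alpha0, alpha1, alpha2;
  cbn -[Cplus Cmult Copp Cinv Cdiv Cminus RtoC IZR PI];
  unfold prod_plus, prod_scal, prod_opp, mult;
  cbn -[Cplus Cmult Copp Cinv Cdiv Cminus RtoC IZR PI];
  match goal with |- @eq _ ?a ?b => change (@eq C a b) end.

(* w0 = r_{alpha_2} t_{- alpha_2 / 2}. *)
Lemma w0_coordinates (tau z1 z2 t : C) :
  r_alpha2 (transl ((- (1 / 2)) *: alpha2)%W (point tau (beta z1 z2) t))
  = point tau (beta (- z2 + tau / 2) (- z1 + tau / 2))
      (t + (z1 + z2) / 2 - tau / 4).
Proof. apply weight_eq; weight_simpl; field. Qed.

Lemma ybar_involutive (ty : heart) (x : weight) : ybar ty (ybar ty x) = x.
Proof.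
destruct ty; [reflexivity|].
destruct x as [[[l a] b] c]; apply weight_eq; weight_simpl; ring.
Qed.

(* On the Cartan subalgebra, e^{-alpha_1} = e^{2 pi i z1},
   e^{-alpha_2} = e^{-2 pi i (z1+z2)}, e^{Lambda_0} = e^{2 pi i t}, e^{-delta} = q. *)
Lemma wexp_coordinates (tau z1 z2 t : C) :
  let h := point tau (beta z1 z2) t in
  wexp ((- (1)) *: alpha1)%W h = e2pi z1 /\
  wexp ((- (1)) *: alpha2)%W h = e2pi (- (z1 + z2)) /\
  wexp Lambda0 h = e2pi t /\
  wexp ((- (1)) *: delta)%W h = e2pi tau.
Proof.
unfold wexp, e2pi; repeat split; f_equal; weight_simpl; field.
Qed.

Lemma form_adm_weight (M m m2 : Z) (ty : heart) (k1 k2 : Z) :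
  let L := adm_weight M m m2 ty k1 k2 in
  RtoC M <> 0 ->
  form L delta = m / M /\
  form L alpha1 =
    match ty with
    | TypeI => - (m / M * k1)
    | TypeIII => m2 - 1 - m / M * (k1 + k2)
    end /\
  form L alpha2 =
    match ty with
    | TypeI => m2 - m / M * k2
    | TypeIII => 2 - m2 + m / M * k2
    end.
Proof.
intros L HM; unfold L, adm_weight; destruct ty;
  repeat split; weight_simpl; field; exact HM.
Qed.

Lemma C_Z_inj (a b : Z) : RtoC a = RtoC b -> a = b.
Proof. intros H; apply eq_IZR, RtoC_inj, H. Qed.

Lemma adm_weight_inj (M m m2 : Z) (ty : heart) (k1 k2 : Z)
    (M' m' m2' : Z) (ty' : heart) (k1' k2' : Z) :
  (0 < M)%Z -> (0 < m)%Z -> Z.gcd M m = 1%Z -> (0 <= m2 <= m)%Z ->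
  Omega ty M k1 k2 ->
  (0 < M')%Z -> (0 < m')%Z -> Z.gcd M' m' = 1%Z -> (0 <= m2' <= m')%Z ->
  Omega ty' M' k1' k2' ->
  adm_weight M m m2 ty k1 k2 = adm_weight M' m' m2' ty' k1' k2' ->
  (M, m, m2, ty, k1, k2) = (M', m', m2', ty', k1', k2').
Proof.
intros HM Hm Hg Hm2 HO HM' Hm' Hg' Hm2' HO' E.
assert (HMC : forall N : Z, (0 < N)%Z -> RtoC N <> 0)
  by (intros N HN H; apply (C_Z_inj N 0) in H; lia).
destruct (form_adm_weight M m m2 ty k1 k2 (HMC _ HM)) as (Ed & E1 & E2).
destruct (form_adm_weight M' m' m2' ty' k1' k2' (HMC _ HM')) as (Ed' & E1' & E2').
rewrite E in Ed, E1, E2; rewrite Ed in Ed'; rewrite E1 in E1'; rewrite E2 in E2'.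
assert (Hx : (m * M' = m' * M)%Z).
{ apply C_Z_inj; rewrite !mult_IZR, !RtoC_mult.
  replace (RtoC m) with (m / M * M) by (field; auto).
  rewrite Ed'; field; auto. }
assert (HMM : M = M').
{ apply Z.divide_antisym_nonneg; try lia.
  - apply Z.gauss with m; [exists m'; lia | exact Hg].
  - apply Z.gauss with m'; [exists m; lia | exact Hg']. }
subst M'.
assert (m = m') by nia; subst m'.
clear Ed Ed' E1 E2 Hg' HM' Hm' Hx E.
(* multiples of M of absolute value less than M vanish *)
assert (K : forall a b : Z, (m * a = M * b)%Z -> (- M < a < M)%Z -> a = 0%Z /\ b = 0%Z).
{ intros a b Hab Ha.
  assert (D : (M | a)%Z) by (apply Z.gauss with m; [exists b; lia | exact Hg]).
  destruct D as [c Hc]; assert (c = 0%Z) by nia; subst; split; nia. }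
assert (HMn := HMC M HM).
assert (T : forall (p q : Z) (x y : C), x = y ->
  RtoC p = q + M * (x - y) -> p = q)
  by (intros p q x y -> H; apply C_Z_inj; rewrite H; ring).
pose proof (fun p q => T p q _ _ E1') as T1.
pose proof (fun p q => T p q _ _ E2') as T2.
Ltac by_T := repeat rewrite ?minus_IZR, ?plus_IZR, ?mult_IZR, ?opp_IZR,
  ?RtoC_minus, ?RtoC_plus, ?RtoC_mult, ?RtoC_opp; field; assumption.
destruct ty, ty'; unfold Omega in HO, HO'.
- assert (A1 : (m * k1' = m * k1)%Z) by (apply T1; by_T).
  assert (A2 : (M * m2 - m * k2 = M * m2' - m * k2')%Z) by (apply T2; by_T).
  destruct (K (k2 - k2') (m2 - m2'))%Z; try lia.
  assert (k1 = k1') by nia; repeat f_equal; lia.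
- assert (A1 : (- (m * k1) = M * (m2' - 1) - m * (k1' + k2'))%Z) by (apply T1; by_T).
  assert (A2 : (M * m2 - m * k2 = M * (2 - m2') + m * k2')%Z) by (apply T2; by_T).
  destruct (K (k1' + k2' - k1) (m2' - 1))%Z; try lia.
  destruct (K (k2 + k2') (m2 + m2' - 2))%Z; lia.
- assert (A1 : (M * (m2 - 1) - m * (k1 + k2) = - (m * k1'))%Z) by (apply T1; by_T).
  assert (A2 : (M * (2 - m2) + m * k2 = M * m2' - m * k2')%Z) by (apply T2; by_T).
  destruct (K (k1 + k2 - k1') (m2 - 1))%Z; try lia.
  destruct (K (k2 + k2') (m2 + m2' - 2))%Z; lia.
- assert (A1 : (M * (m2 - 1) - m * (k1 + k2) = M * (m2' - 1) - m * (k1' + k2'))%Z)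
    by (apply T1; by_T).
  assert (A2 : (M * (2 - m2) + m * k2 = M * (2 - m2') + m * k2')%Z)
    by (apply T2; by_T).
  destruct (K (k1 + k2 - (k1' + k2')) (m2 - m2'))%Z; try lia.
  destruct (K (k2 - k2') (m2 - m2'))%Z; try lia.
  repeat f_equal; lia.
Qed.

(* Main.v *)
Require Import Defs.
From Stdlib Require Import Reals ZArith Lra Lia Classical.
From Coquelicot Require Import Coquelicot.

Open Scope C_scope.

(** The numerator of L(Lambda^{(m,n)}) is an alternating sum, under the
    reflection r_theta, of one theta-like series with the double denominator
    (1 +- x)^2, where x = e^{-alpha_1} = e^{-alpha_3} is translated by j theta.
    Raising n by one multiplies the j-th numerator by x^{-1}.  Hence, in the sum
    of the modules with parameters n and n + 1, the two j-th terms combine with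
    the factor x +- 1 = +- (1 +- x), which cancels one of the two denominator
    factors ([num_summand_add]).  What is left is, after j -> - j, the j-th term
    of Phi_1^{[m,-n]}: at the plain point for supercharacters, and at a point
    shifted by 1/2 for characters, since there 1 + x has to be written as
    1 - e^{i pi} x; the shift is also the origin of the sign (-1)^n.  The
    reflection r_theta exchanges z_1 and z_2, which turns Phi_1 into Phi_2, so
    the whole numerator is a multiple of Phi^{[m,-n]} ([num_L_add]).

    This combination takes place inside bilateral series, so it rests on their
    absolute convergence ([Zsummable_num_summand]): the numerators decay like
    |q|^{m j^2} and the denominators stay away from zero for large |j|.

    For the admissible weights of type I one evaluates the identity at a point
    moved by tau beta; the exponential factor produced by beta, together with the
    value of t in the reduction, is the prefactor of Psi
    ([num_ddotL_I_Psi]).  Type III is type I at (- z_2, - z_1), because r_{alpha_2}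
    is an isometry that exchanges the two vectors beta ([num_ddotL_III]); the
    twist w_0 is again this exchange, together with a shift by tau/2.
    The eight formulas are thus one identity at different points. *)

(** * The exponential e2pi *)

Lemma cexp_plus (u v : C) : cexp (u + v) = cexp u * cexp v.
Proof.
unfold cexp; destruct u as [a b], v as [c d]; cbn.
rewrite exp_plus, cos_plus, sin_plus; apply injective_projections; cbn; ring.
Qed.

Lemma Cmod_cexp (w : C) : Cmod (cexp w) = exp (Re w).
Proof.
unfold cexp, Cmod; cbn [fst snd].
replace ((exp (Re w) * cos (Im w)) ^ 2 + (exp (Re w) * sin (Im w)) ^ 2)%R
  with (Rsqr (exp (Re w)) * (Rsqr (sin (Im w)) + Rsqr (cos (Im w))))%R
  by (unfold Rsqr; ring).
rewrite sin2_cos2, Rmult_1_r; apply sqrt_Rsqr, Rlt_le, exp_pos.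
Qed.

Lemma e2pi_plus (u v : C) : e2pi (u + v) = e2pi u * e2pi v.
Proof. unfold e2pi; rewrite <- cexp_plus; f_equal; ring. Qed.

Lemma Cmod_e2pi (w : C) : Cmod (e2pi w) = exp (- (2 * PI * Im w)).
Proof. unfold e2pi; rewrite Cmod_cexp; f_equal; destruct w; cbn; ring. Qed.

Lemma e2pi_0 : e2pi 0 = 1.
Proof.
unfold e2pi, cexp.
replace (2 * PI * Ci * 0) with (RtoC 0) by ring; cbn.
rewrite exp_0, cos_0, sin_0; apply injective_projections; cbn; ring.
Qed.

Lemma e2pi_half : e2pi (RtoC (1 / 2)) = - (1).
Proof.
unfold e2pi, cexp.
replace (Re (2 * PI * Ci * RtoC (1 / 2))) with 0%R by (cbn; field).
replace (Im (2 * PI * Ci * RtoC (1 / 2))) with PI by (cbn; field).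
rewrite exp_0, cos_PI, sin_PI; apply injective_projections; cbn; ring.
Qed.

Lemma e2pi_opp_nat_half (n : nat) :
  e2pi (- (RtoC (INR n) * RtoC (1 / 2))) * RtoC ((-1) ^ n) = 1.
Proof.
induction n as [|n IH].
- cbn [INR pow]; replace (- (0 * RtoC (1 / 2))) with (RtoC 0) by ring.
  rewrite e2pi_0; ring.
- assert (H : e2pi (- RtoC (1 / 2)) = - (1)).
  { assert (E : e2pi (- RtoC (1 / 2)) * e2pi (RtoC (1 / 2)) = 1).
    { rewrite <- e2pi_plus.
      replace (- RtoC (1 / 2) + RtoC (1 / 2)) with (RtoC 0) by ring.
      exact e2pi_0. }
    rewrite e2pi_half in E; rewrite <- E; ring. }
  rewrite S_INR, RtoC_plus; cbn [pow]; rewrite RtoC_mult.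
  replace (- ((INR n + 1) * RtoC (1 / 2)))
    with (- (INR n * RtoC (1 / 2)) + - RtoC (1 / 2)) by ring.
  rewrite e2pi_plus, H.
  replace (RtoC (-1)) with (- (1)) by (apply injective_projections; cbn; ring).
  etransitivity; [| exact IH]; ring.
Qed.

(** * Division with the convention / 0 = 0 *)

Lemma Cinv_0 : / RtoC 0 = 0.
Proof.
apply injective_projections; cbn; unfold Rdiv; ring.
Qed.

(** At b = 0 or c = 0 both sides are 0 because / 0 = 0.  It serves to invert the
    N=4 denominators, quotients of theta functions and eta. *)
Lemma Cdiv_mult_div (x a b c : C) : a <> 0 -> x / (a * (b / c)) = / a * x * (c / b).
Proof.
intros Ha; unfold Cdiv.
destruct (classic (b = 0)) as [-> | Hb];
  [| destruct (classic (c = 0)) as [-> | Hc]].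
- rewrite Cinv_0, !Cmult_0_l, !Cmult_0_r, Cinv_0; ring.
- rewrite Cinv_0, !Cmult_0_r, Cinv_0; ring.
- field; auto.
Qed.

(** At y = 0, a pole of the series, both sides take the value x / 0 = 0. *)
Lemma Cdiv_sqr_cancel (x y : C) : x * y / (y * y) = x / y.
Proof.
destruct (classic (y = 0)) as [-> | Hy]; [| field; exact Hy].
unfold Cdiv; rewrite Cmult_0_l, Cinv_0; ring.
Qed.

(** * Absolutely convergent bilateral series *)

Definition Zsummable (u : Z -> C) : Prop :=
  ex_series (fun n : nat => Cmod (u (Z.of_nat n))) /\
  ex_series (fun n : nat => Cmod (u (- Z.of_nat (S n))%Z)).

Lemma ex_series_Re (u : nat -> C) :
  ex_series (fun n => Cmod (u n)) -> ex_series (fun n => Re (u n)).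
Proof.
apply (@ex_series_le R_AbsRing R_CompleteNormedModule); intros n.
apply re_le_Cmod.
Qed.

Lemma ex_series_Im (u : nat -> C) :
  ex_series (fun n => Cmod (u n)) -> ex_series (fun n => Im (u n)).
Proof.
apply (@ex_series_le R_AbsRing R_CompleteNormedModule); intros n.
eapply Rle_trans; [apply Rmax_r | apply Rmax_Cmod].
Qed.

Lemma Cseries_ext (u v : nat -> C) : (forall n, u n = v n) -> Cseries u = Cseries v.
Proof.
intros H; unfold Cseries; f_equal; apply Series_ext; intros n; now rewrite H.
Qed.

Lemma Zseries_ext (u v : Z -> C) : (forall j, u j = v j) -> Zseries u = Zseries v.
Proof. intros H; unfold Zseries; f_equal; apply Cseries_ext; auto. Qed.

Lemma Cseries_plus (u v : nat -> C) :
  ex_series (fun n => Cmod (u n)) -> ex_series (fun n => Cmod (v n)) ->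
  Cseries (fun n => u n + v n) = Cseries u + Cseries v.
Proof.
intros Hu Hv; unfold Cseries.
apply injective_projections; cbn; rewrite <- Series_plus; auto using ex_series_Re, ex_series_Im.
Qed.

Lemma Cseries_scal (c : C) (u : nat -> C) :
  ex_series (fun n => Cmod (u n)) -> Cseries (fun n => c * u n) = c * Cseries u.
Proof.
intros Hu; unfold Cseries.
apply injective_projections; cbn -[Series Re Im]; rewrite <- !Series_scal_l.
- rewrite <- Series_minus; [reflexivity | |];
    apply (@ex_series_scal R_AbsRing R_NormedModule); auto using ex_series_Re, ex_series_Im.
- rewrite <- Series_plus; [reflexivity | |];
    apply (@ex_series_scal R_AbsRing R_NormedModule); auto using ex_series_Re, ex_series_Im.
Qed.

Lemma Cseries_incr_1 (u : nat -> C) :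
  ex_series (fun n => Cmod (u n)) ->
  Cseries u = u 0%nat + Cseries (fun n => u (S n)).
Proof.
intros Hu; unfold Cseries; apply injective_projections; cbn -[Series Re Im].
- rewrite Series_incr_1 by now apply ex_series_Re. reflexivity.
- rewrite Series_incr_1 by now apply ex_series_Im. reflexivity.
Qed.

Lemma Zseries_plus (u v : Z -> C) :
  Zsummable u -> Zsummable v -> Zseries (fun j => u j + v j) = Zseries u + Zseries v.
Proof.
intros [Hu Hu'] [Hv Hv']; unfold Zseries.
rewrite !Cseries_plus by assumption; ring.
Qed.

Lemma Zseries_scal (c : C) (u : Z -> C) :
  Zsummable u -> Zseries (fun j => c * u j) = c * Zseries u.
Proof.
intros [Hu Hu']; unfold Zseries.
rewrite (Cseries_scal c (fun n => u (Z.of_nat n))) by assumption.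
rewrite (Cseries_scal c (fun n => u (- Z.of_nat (S n))%Z)) by assumption; ring.
Qed.

(** The two halves of a bilateral sum are cut between - 1 and 0, so reflection
    moves the term at 0 from one half to the other; this is where convergence
    enters. *)
Lemma Zseries_reflect (u : Z -> C) :
  Zsummable u -> Zseries (fun j => u (- j)%Z) = Zseries u.
Proof.
intros [Hu Hu']; unfold Zseries.
rewrite (Cseries_incr_1 (fun n => u (Z.of_nat n))) by assumption.
rewrite (Cseries_incr_1 (fun n => u (- Z.of_nat n)%Z))
  by exact (proj2 (ex_series_incr_1 (fun n => Cmod (u (- Z.of_nat n)%Z))) Hu').
rewrite (Cseries_ext (fun n => u (- - Z.of_nat (S n))%Z) (fun n => u (Z.of_nat (S n))))
  by (intros n; now rewrite Z.opp_involutive).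
cbn [Z.of_nat Z.opp]; ring.
Qed.

Lemma Zsummable_scal (c : C) (u : Z -> C) :
  Zsummable u -> Zsummable (fun j => c * u j).
Proof.
assert (H : forall v : nat -> C, ex_series (fun n => Cmod (v n)) ->
  ex_series (fun n => Cmod (c * v n))).
{ intros v Hv; apply (ex_series_ext (fun n => scal (Cmod c) (Cmod (v n)) : R)).
  - intros n; now rewrite Cmod_mult.
  - now apply (@ex_series_scal R_AbsRing R_NormedModule). }
intros [Hu Hu']; split; now apply H.
Qed.

Lemma Zsummable_ext (u v : Z -> C) :
  (forall j, u j = v j) -> Zsummable u -> Zsummable v.
Proof.
intros H [Hu Hu']; split.
- refine (ex_series_ext _ _ _ Hu); intros n; now rewrite H.
- refine (ex_series_ext _ _ _ Hu'); intros n; now rewrite H.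
Qed.

Lemma Zsummable_reflect (u : Z -> C) :
  Zsummable u -> Zsummable (fun j => u (- j)%Z).
Proof.
intros [Hu Hu']; split.
- exact (proj2 (ex_series_incr_1 (fun n => Cmod (u (- Z.of_nat n)%Z))) Hu').
- apply (ex_series_incr_1 (fun n => Cmod (u (Z.of_nat n)))) in Hu.
  refine (ex_series_ext _ _ _ Hu); intros n; now rewrite Z.opp_involutive.
Qed.

Lemma Zsummable_plus (u v : Z -> C) :
  Zsummable u -> Zsummable v -> Zsummable (fun j => u j + v j).
Proof.
assert (H : forall a b : nat -> C, ex_series (fun n => Cmod (a n)) ->
  ex_series (fun n => Cmod (b n)) -> ex_series (fun n => Cmod (a n + b n))).
{ intros a b Ha Hb.
  apply (@ex_series_le R_AbsRing R_CompleteNormedModule)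
    with (fun n => plus (Cmod (a n)) (Cmod (b n))).
  - intros n; unfold norm; cbn; unfold abs; cbn.
    rewrite Rabs_pos_eq by apply Cmod_ge_0; apply Cmod_triangle.
  - now apply (@ex_series_plus R_AbsRing R_NormedModule). }
intros [Hu Hu'] [Hv Hv']; split.
- now apply (H (fun n => u (Z.of_nat n)) (fun n => v (Z.of_nat n))).
- now apply (H (fun n => u (- Z.of_nat (S n))%Z) (fun n => v (- Z.of_nat (S n))%Z)).
Qed.

(** * Convergence of Appell-type series *)

Lemma exp_le (x y : R) : (x <= y)%R -> (exp x <= exp y)%R.
Proof. intros [H | ->]; [now apply Rlt_le, exp_increasing | apply Rle_refl]. Qed.

Lemma exp_opp_INR (n : nat) : exp (- INR n) = (exp (-1) ^ n)%R.
Proof.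
induction n as [|n IH].
- cbn; rewrite Ropp_0; apply exp_0.
- rewrite S_INR; cbn [pow]; rewrite <- IH, <- exp_plus; f_equal; ring.
Qed.

(** Once a n >= b + 1 the exponent is at most c - n, so the tail is dominated by
    a geometric series of ratio 1/e. *)
Lemma ex_series_gaussian (a b c : R) :
  (0 < a)%R -> ex_series (fun n => exp (c + b * INR n - a * INR n ^ 2)).
Proof.
intros Ha.
destruct (INR_unbounded ((b + 1) / a)) as [N HN].
apply (ex_series_incr_n _ N).
apply (@ex_series_le R_AbsRing R_CompleteNormedModule)
  with (fun n => scal (exp c) (exp (-1) ^ n)%R).
- intros n; unfold norm; cbn; unfold abs; cbn; unfold mult; cbn.
  rewrite Rabs_pos_eq by apply Rlt_le, exp_pos.
  rewrite <- exp_opp_INR, <- exp_plus.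
  apply exp_le.
  assert (Hn : (INR n <= INR (N + n))%R) by (apply le_INR; lia).
  assert (HN' : (INR N <= INR (N + n))%R) by (apply le_INR; lia).
  set (x := INR (N + n)) in *.
  assert (0 <= INR n)%R by apply pos_INR.
  assert (Hb : (b + 1 <= a * x)%R).
  { apply Rmult_le_reg_r with (/ a)%R; [now apply Rinv_0_lt_compat|].
    replace (a * x * / a)%R with x by (field; lra).
    unfold Rdiv in HN; lra. }
  nra.
- apply (@ex_series_scal R_AbsRing R_NormedModule), ex_series_geom.
  rewrite Rabs_pos_eq by apply Rlt_le, exp_pos.
  rewrite <- exp_0; apply exp_increasing; lra.
Qed.

Lemma Cmod_one_plus_ge (w : C) :
  (Cmod w <= 1 / 2 \/ 2 <= Cmod w)%R -> (1 / 2 <= Cmod (1 + w))%R.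
Proof.
intros H.
assert (H1 := Cmod_triangle (1 + w) (- w)).
assert (H2 := Cmod_triangle (1 + w) (- (1))).
replace (1 + w + - w) with (RtoC 1) in H1 by ring.
replace (1 + w + - (1)) with w in H2 by ring.
rewrite Cmod_opp, Cmod_1 in *; lra.
Qed.

Lemma exp_le_half (x : R) : (x <= -1)%R -> (exp x <= 1 / 2)%R.
Proof.
intros Hx.
assert (H : (2 <= exp 1)%R) by (apply Rlt_le; replace 2%R with (1 + 1)%R by ring; apply exp_ineq1; lra).
apply Rle_trans with (exp (- (1))); [apply exp_le; lra|].
rewrite exp_Ropp; unfold Rdiv; rewrite Rmult_1_l.
apply Rinv_le_contravar; lra.
Qed.

Lemma two_le_exp (x : R) : (1 <= x)%R -> (2 <= exp x)%R.
Proof. intros Hx; assert (H := exp_ineq1_le x); lra. Qed.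

(** The modulus of e2pi (z + n w) tends to 0 or to infinity according to the
    sign of Im w; as soon as it is outside the interval (1/2, 2) the denominator
    is bounded below by the triangle inequality. *)
Lemma eventually_denominator_ge (sigma z w : C) :
  Cmod sigma = 1%R -> Im w <> 0%R ->
  exists N : nat, forall n : nat, (N <= n)%nat ->
    (1 / 2 <= Cmod (1 + sigma * e2pi (z + INR n * w)))%R.
Proof.
intros Hs Hw.
assert (HP : (0 < 2 * PI * Rabs (Im w))%R).
{ assert (H := PI_RGT_0); assert (H' := Rabs_pos_lt _ Hw); nra. }
destruct (INR_unbounded ((1 + 2 * PI * Rabs (Im z)) / (2 * PI * Rabs (Im w)))) as [N HN].
exists N; intros n Hn; apply le_INR in Hn.
assert (K : (1 + 2 * PI * Rabs (Im z) <= INR n * (2 * PI * Rabs (Im w)))%R).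
{ apply Rmult_le_reg_r with (/ (2 * PI * Rabs (Im w)))%R; [now apply Rinv_0_lt_compat|].
  set (D := (2 * PI * Rabs (Im w))%R) in *.
  replace (INR n * D * / D)%R with (INR n) by (field; lra).
  unfold Rdiv in HN; lra. }
apply Cmod_one_plus_ge.
rewrite Cmod_mult, Hs, Rmult_1_l, Cmod_e2pi.
replace (Im (z + INR n * w)) with (Im z + INR n * Im w)%R
  by (destruct z, w; cbn; ring).
assert (H := PI_RGT_0).
destruct (Rlt_or_le 0 (Im w)) as [L | L].
- left; apply exp_le_half; rewrite (Rabs_pos_eq (Im w)) in K by lra.
  assert (H1 := Rle_abs (- Im z)); rewrite Rabs_Ropp in H1; nra.
- right; apply two_le_exp; rewrite (Rabs_left1 (Im w)) in K by lra.
  assert (H1 := Rle_abs (Im z)); nra.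
Qed.

(** Stated for one half of a bilateral series, with w free to point up or down,
    so that it serves for j -> + infinity and for j -> - infinity. *)
Lemma ex_series_appell (a b kappa sigma z w : C) :
  (0 < Im kappa)%R -> Cmod sigma = 1%R -> Im w <> 0%R ->
  ex_series (fun n : nat =>
    Cmod (e2pi (a + b * INR n + kappa * INR n ^ 2)
          / ((1 + sigma * e2pi (z + INR n * w)) * (1 + sigma * e2pi (z + INR n * w))))).
Proof.
intros Hk Hs Hw.
destruct (eventually_denominator_ge sigma z w Hs Hw) as [N HN].
assert (HP := PI_RGT_0).
assert (G := ex_series_gaussian (2 * PI * Im kappa) (- (2 * PI * Im b))
               (- (2 * PI * Im a)) ltac:(nra)).
apply (ex_series_incr_n _ N) in G; apply (ex_series_incr_n _ N).
apply (@ex_series_scal R_AbsRing R_NormedModule 4%R) in G.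
refine (@ex_series_le R_AbsRing R_CompleteNormedModule _ _ _ G).
intros n; specialize (HN (N + n)%nat (Nat.le_add_r N n)).
set (x := INR (N + n)) in *; set (d := 1 + _) in *.
assert (Hd : d <> 0) by (intros E; rewrite E, Cmod_0 in HN; lra).
change (Rabs (Cmod (e2pi (a + b * x + kappa * x ^ 2) / (d * d)))
  <= 4 * exp (- (2 * PI * Im a) + - (2 * PI * Im b) * x - 2 * PI * Im kappa * x ^ 2))%R.
rewrite Rabs_pos_eq by apply Cmod_ge_0.
rewrite Cmod_div, Cmod_mult, Cmod_e2pi by now apply Cmult_neq_0.
replace (- (2 * PI * Im (a + b * x + kappa * x ^ 2)))%R
  with (- (2 * PI * Im a) + - (2 * PI * Im b) * x - 2 * PI * Im kappa * x ^ 2)%R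
  by (destruct a, b, kappa; cbn; ring).
rewrite (Rmult_comm 4); unfold Rdiv.
apply Rmult_le_compat_l; [apply Rlt_le, exp_pos|].
replace 4%R with (/ (1 / 2 * (1 / 2)))%R by field.
apply Rinv_le_contravar; nra.
Qed.

(** * The numerators as Appell-type series *)

(** The term of index j of the numerator of L(Lambda^{(m,n)}); n - 1 rather than
    n appears because rho = - alpha_1 on the Cartan subalgebra. *)
Definition num_summand (s : Defs.sign) (m n : Z) (tau z1 z2 t : C) (j : Z) : C :=
  e2pi (m * t - (n - 1) * z1 + m * j * (z2 - z1) + (m * j ^ 2 + j * (n - 1)) * tau)
  / ((1 + sgn s * e2pi (z1 - j * tau)) * (1 + sgn s * e2pi (z1 - j * tau))).

Lemma summand_congr (sigma u u' v v' : C) :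
  u = u' -> v = v' ->
  cexp u / ((1 + sigma * cexp v) * (1 + sigma * cexp v))
  = cexp u' / ((1 + sigma * cexp v') * (1 + sigma * cexp v')).
Proof. intros -> ->; reflexivity. Qed.

Lemma F_term_transl (s : Defs.sign) (m n j : Z) (tau z1 z2 t : C) :
  F_term s m n (fun x => transl (j *: theta_root)%W x) (point tau (beta z1 z2) t)
  = num_summand s m n tau z1 z2 t j.
Proof.
unfold F_term, num_summand, wexp, e2pi, alpha3.
apply summand_congr; weight_simpl; field.
Qed.

Lemma form_r_theta (x y : weight) : form (r_theta x) y = form x (r_theta y).
Proof.
destruct x as [[[l a] b] c], y as [[[l' a'] b'] c']; weight_simpl; ring.
Qed.

Lemma r_theta_point (tau z1 z2 t : C) :
  r_theta (point tau (beta z1 z2) t) = point tau (beta z2 z1) t.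
Proof. apply weight_eq; weight_simpl; field. Qed.

(** r_theta is an isometry that exchanges z_1 and z_2, so moving it from the
    weight to the point reduces this to [F_term_transl]. *)
Lemma F_term_r_theta (s : Defs.sign) (m n j : Z) (tau z1 z2 t : C) :
  F_term s m n (fun x => r_theta (transl (j *: theta_root)%W x))
    (point tau (beta z1 z2) t)
  = num_summand s m n tau z2 z1 t j.
Proof.
rewrite <- F_term_transl, <- (r_theta_point tau z1 z2 t).
unfold F_term, wexp; now rewrite !form_r_theta.
Qed.

Lemma Cmod_sgn (s : Defs.sign) : Cmod (sgn s) = 1%R.
Proof. destruct s; cbn [sgn]; rewrite ?Cmod_opp; apply Cmod_1. Qed.

Lemma Zsummable_num_summand (s : Defs.sign) (m n : Z) (tau z1 z2 t : C) :
  (0 < m)%Z -> (0 < Im tau)%R -> Zsummable (num_summand s m n tau z1 z2 t).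
Proof.
intros Hm Ht; apply IZR_lt in Hm.
assert (Hk : (0 < Im (m * tau))%R) by (destruct tau; cbn in *; nra).
assert (Hw : (Im tau <> 0)%R) by lra.
assert (Hw' : (Im (- tau) <> 0)%R) by (destruct tau; cbn in *; lra).
split.
- refine (ex_series_ext _ _ _
    (ex_series_appell (m * t - (n - 1) * z1) (m * (z2 - z1) + (n - 1) * tau)
       (m * tau) (sgn s) z1 (- tau) Hk (Cmod_sgn s) Hw')).
  intros k; unfold num_summand; rewrite <- INR_IZR_INZ.
  apply f_equal, summand_congr; f_equal; ring.
- refine (ex_series_ext _ _ _
    (ex_series_appell (m * t - (n - 1) * z1 - m * (z2 - z1) + (m - (n - 1)) * tau)
       (- (m * (z2 - z1)) + (2 * m - (n - 1)) * tau)
       (m * tau) (sgn s) (z1 + tau) tau Hk (Cmod_sgn s) Hw)).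
  intros k; unfold num_summand.
  rewrite opp_IZR, <- INR_IZR_INZ, S_INR, RtoC_opp, RtoC_plus.
  apply f_equal, summand_congr; f_equal; ring.
Qed.

(** * From double to simple denominators *)

(** The shift epsilon of the first variable, chosen so that
    1 + sgn s * x = 1 - e2pi (shift s) * x. *)
Definition shift (s : Defs.sign) : R :=
  match s with SPlus => (1 / 2)%R | SMinus => 0%R end.

(** The constant lost in the passage to Phi: (-1)^n comes from the factor
    e^{2 pi i s z_1} of Phi_1 with s = - n at a point shifted by 1/2, while - 1
    is the factor in x - 1 = - (1 - x). *)
Definition phase (s : Defs.sign) (n : Z) : C :=
  match s with SPlus => powerRZ (-1) n | SMinus => - (1) end.

Lemma e2pi_shift (s : Defs.sign) : e2pi (shift s) = - sgn s.
Proof.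
destruct s; cbn [shift sgn]; [apply e2pi_half | rewrite e2pi_0; ring].
Qed.

Lemma phase_shift (s : Defs.sign) (n : Z) :
  (0 <= n)%Z -> phase s n * e2pi (- (n * shift s)) = sgn s.
Proof.
intros Hn; destruct s; cbn [shift sgn phase].
- rewrite <- (Z2Nat.id n Hn), <- pow_powerRZ, <- INR_IZR_INZ, Cmult_comm.
  apply e2pi_opp_nat_half.
- replace (- (n * 0)) with (RtoC 0) by ring; rewrite e2pi_0; ring.
Qed.

Definition Phi1_summand (m s : R) (tau z1 z2 : C) (j : Z) : C :=
  e2pi (m * j * (z1 + z2) + s * z1) * qpow tau (m * j ^ 2 + s * j)
  / (1 - e2pi z1 * qpow tau j).

(** With E the common exponential, the two terms are E x / (1 +- x)^2 and
    E / (1 +- x)^2.  Their signed sum has the numerator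
    E (x +- 1) = +- E (1 +- x), which removes one factor of the denominator. *)
Lemma num_summand_add (s : Defs.sign) (m n j : Z) (tau z1 z2 t : C) :
  (0 <= n)%Z ->
  num_summand s m n tau z1 z2 t j + sgn s * num_summand s m (n + 1) tau z1 z2 t j
  = phase s n * e2pi (m * t)
    * Phi1_summand m (- n) tau (z1 + shift s) (- z2 - shift s) (- j).
Proof.
intros Hn; unfold num_summand, Phi1_summand, qpow.
(* E is the numerator for n + 1, and E x the one for n. *)
set (E := e2pi (m * t - n * z1 + m * j * (z2 - z1) + (m * j ^ 2 + j * n) * tau)).
set (x := e2pi (z1 - j * tau)).
replace (e2pi (m * t - (n - 1) * z1 + m * j * (z2 - z1)
               + (m * j ^ 2 + j * (n - 1)) * tau)) with (E * x)
  by (unfold E, x; rewrite <- e2pi_plus; f_equal; ring).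
replace (e2pi (m * t - ((n + 1)%Z - 1) * z1 + m * j * (z2 - z1)
               + (m * j ^ 2 + j * ((n + 1)%Z - 1)) * tau)) with E
  by (unfold E; rewrite plus_IZR, RtoC_plus; f_equal; ring).
rewrite opp_IZR, !RtoC_opp, e2pi_plus.
assert (Hd : e2pi z1 * e2pi (shift s) * e2pi (- j * tau) = - (sgn s * x)).
{ rewrite e2pi_shift; unfold x.
  replace (z1 - j * tau) with (z1 + - j * tau) by ring; rewrite e2pi_plus; ring. }
rewrite (e2pi_plus z1), Hd.
(* The phase absorbs the factor e2pi (- n * shift s) of the shifted point. *)
assert (Hn' : phase s n * e2pi (m * t)
   * (e2pi (m * - j * (z1 + shift s + (- z2 - shift s)))
      * e2pi (- n * (z1 + shift s)) * e2pi ((m * (- j) ^ 2 + - n * - j) * tau))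
   = sgn s * E).
{ rewrite <- (phase_shift s n Hn), <- !Cmult_assoc; f_equal.
  unfold E; rewrite <- !e2pi_plus; f_equal; ring. }
unfold Cdiv at 3; rewrite Cmult_assoc, Hn'.
assert (Hs : sgn s * sgn s = 1) by (destruct s; cbn; ring).
replace (1 - - (sgn s * x)) with (1 + sgn s * x) by ring.
change (sgn s * E * / (1 + sgn s * x)) with (sgn s * E / (1 + sgn s * x)).
rewrite <- (Cdiv_sqr_cancel (sgn s * E) (1 + sgn s * x)).
replace (sgn s * E * (1 + sgn s * x)) with (E * (sgn s + sgn s * sgn s * x)) by ring.
rewrite Hs; unfold Cdiv; ring.
Qed.

Lemma e2pi_neq_0 (w : C) : e2pi w <> 0.
Proof.
intros E; assert (H := exp_pos (- (2 * PI * Im w))).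
rewrite <- Cmod_e2pi, E, Cmod_0 in H; lra.
Qed.

Lemma phase_neq_0 (s : Defs.sign) (n : Z) : phase s n <> 0.
Proof.
destruct s; cbn [phase]; intros E.
- apply RtoC_inj in E; revert E; apply powerRZ_NOR; lra.
- apply C1_nz; replace (RtoC 1) with (- - (1)) by ring; rewrite E; ring.
Qed.

(** The sums of the two numerators converge absolutely separately, so they may
    be added term by term; the absolute convergence of the series of Phi_1 is
    inherited from theirs through the nonzero constant between the terms. *)
Lemma num_series_add (s : Defs.sign) (m n : Z) (tau z1 z2 t : C) :
  (0 < m)%Z -> (0 <= n)%Z -> (0 < Im tau)%R ->
  Zseries (num_summand s m n tau z1 z2 t)
  + sgn s * Zseries (num_summand s m (n + 1) tau z1 z2 t)
  = phase s n * Phi1 m (- n) tau (z1 + shift s) (- z2 - shift s) (- t).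
Proof.
intros Hm Hn Ht.
assert (S1 := Zsummable_num_summand s m n tau z1 z2 t Hm Ht).
assert (S2 := Zsummable_num_summand s m (n + 1) tau z1 z2 t Hm Ht).
rewrite <- Zseries_scal, <- Zseries_plus by auto using Zsummable_scal.
assert (S3 := Zsummable_plus _ _ S1 (Zsummable_scal (sgn s) _ S2)).
rewrite <- Zseries_reflect by exact S3.
set (v := Phi1_summand m (- n) tau (z1 + shift s) (- z2 - shift s)).
assert (Hv : forall j, num_summand s m n tau z1 z2 t (- j)
    + sgn s * num_summand s m (n + 1) tau z1 z2 t (- j)
  = phase s n * e2pi (m * t) * v j)
  by (intros j; unfold v; rewrite num_summand_add, Z.opp_involutive; auto).
assert (Hc : phase s n * e2pi (m * t) <> 0)
  by (apply Cmult_neq_0; [exact (phase_neq_0 s n) | exact (e2pi_neq_0 _)]).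
assert (Sv : Zsummable v).
{ apply (Zsummable_ext (fun j => / (phase s n * e2pi (m * t))
     * (num_summand s m n tau z1 z2 t (- j)
        + sgn s * num_summand s m (n + 1) tau z1 z2 t (- j)))).
  - intros j; rewrite Hv, Cmult_assoc, Cinv_l, Cmult_1_l; auto.
  - apply Zsummable_scal, (Zsummable_reflect _ S3). }
rewrite (Zseries_ext _ _ Hv), Zseries_scal by exact Sv.
unfold Phi1; fold (Phi1_summand m (- n) tau (z1 + shift s) (- z2 - shift s)); fold v.
replace (- (m * - t)) with (m * t) by ring; ring.
Qed.

(** This symmetry lets the r_theta half of a numerator be treated by the same
    series identity as the other half. *)
Lemma Phi2_Phi1 (m s : R) (tau z1 z2 t : C) :
  Phi2 m s tau z1 z2 t = Phi1 m s tau (- z2) (- z1) t.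
Proof.
unfold Phi1, Phi2; f_equal; apply Zseries_ext; intros j.
replace (- (m * j * (z1 + z2)) - s * z2)
  with (m * j * (- z2 + - z1) + s * - z2) by ring.
reflexivity.
Qed.

Lemma Phi_t_factor (m s : R) (tau z1 z2 t : C) :
  Phi m s tau z1 z2 t = e2pi (- (m * t)) * Phi m s tau z1 z2 0.
Proof.
unfold Phi, Phi1, Phi2; replace (- (m * 0)) with (RtoC 0) by ring.
rewrite e2pi_0; ring.
Qed.

Lemma num_L_series (s : Defs.sign) (m n : Z) (tau z1 z2 t : C) :
  num_L s m n (point tau (beta z1 z2) t)
  = Zseries (num_summand s m n tau z1 z2 t) - Zseries (num_summand s m n tau z2 z1 t).
Proof.
unfold num_L, F_sum; f_equal; apply Zseries_ext; intros j.
- apply F_term_transl.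
- apply F_term_r_theta.
Qed.

(** The r_theta half is the first half with z_1 and z_2 exchanged, and so yields
    Phi_1 at (z_2 + shift, - z_1 - shift), that is, Phi_2 at
    (z_1 + shift, - z_2 - shift). *)
Lemma num_L_add (s : Defs.sign) (m n : Z) (tau z1 z2 t : C) :
  (0 < m)%Z -> (0 <= n)%Z -> (0 < Im tau)%R ->
  num_L s m n (point tau (beta z1 z2) t)
  + sgn s * num_L s m (n + 1) (point tau (beta z1 z2) t)
  = phase s n * e2pi (m * t)
    * Phi m (- n) tau (z1 + shift s) (- z2 - shift s) 0.
Proof.
intros Hm Hn Ht; rewrite !num_L_series.
replace (e2pi (m * t)) with (e2pi (- (m * - t))) by (f_equal; ring).
rewrite <- Cmult_assoc, <- Phi_t_factor; unfold Phi; rewrite Phi2_Phi1.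
replace (- (- z2 - shift s)) with (z2 + shift s) by ring.
replace (- (z1 + shift s)) with (- z1 - shift s) by ring.
transitivity (
  (Zseries (num_summand s m n tau z1 z2 t)
   + sgn s * Zseries (num_summand s m (n + 1) tau z1 z2 t))
  - (Zseries (num_summand s m n tau z2 z1 t)
     + sgn s * Zseries (num_summand s m (n + 1) tau z2 z1 t))); [ring |].
rewrite !num_series_add by assumption; ring.
Qed.

(** * Admissible weights *)

(** r_{alpha_2} preserves the form and maps the point (z_1, z_2) to
    (- z_2, - z_1) and the vector beta of type III to that of type I. *)
Lemma num_ddotL_III (s : Defs.sign) (M m n k1 k2 : Z) (tau z1 z2 t : C) :
  num_ddotL s M m n TypeIII k1 k2 tau z1 z2 t
  = num_ddotL s M m n TypeI k1 k2 tau (- z2) (- z1) t.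
Proof.
unfold num_ddotL, num_adm; cbn [ybar].
replace (1 / M * (t + form (beta z1 z2) (beta_adm TypeIII k1 k2)
    + tau * form (beta_adm TypeIII k1 k2) (beta_adm TypeIII k1 k2) / 2))
  with (1 / M * (t + form (beta (- z2) (- z1)) (beta_adm TypeI k1 k2)
    + tau * form (beta_adm TypeI k1 k2) (beta_adm TypeI k1 k2) / 2))
  by (unfold Cdiv at 1 4; f_equal; weight_simpl; field).
replace (r_alpha2 (beta z1 z2 + tau *: beta_adm TypeIII k1 k2)%W)
  with (beta (- z2) (- z1) + tau *: beta_adm TypeI k1 k2)%W
  by (apply weight_eq; weight_simpl; field).
reflexivity.
Qed.

(** The third coordinate is the one for which the exponents match: the translation
    by beta contributes (w1 + a tau) (k1 + k2) + (w2 + b tau) k1 + k1 (k1 + k2) tau,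
    and Psi requires j k tau + k w1 + j w2 with j = k1 + a, k = k1 + k2 + b. *)
Lemma num_ddotL_I_Psi (s : Defs.sign) (M m n k1 k2 : Z) (a b : R) (tau w1 w2 : C) :
  (0 < M)%Z -> (0 < m)%Z -> (0 <= n)%Z -> (0 < Im tau)%R ->
  num_ddotL s M m n TypeI k1 k2 tau (w1 + a * tau) (- (w2 + b * tau))
    (a * b * tau + b * w1 + a * w2)
  = phase s n * Psi M m (- n) (shift s) (k1 + a) (k1 + k2 + b) tau w1 w2 0.
Proof.
intros HM Hm Hn Ht.
assert (HMC : RtoC M <> 0) by (intros E; apply (C_Z_inj M 0) in E; lia).
unfold num_ddotL, num_adm; cbn [ybar].
replace (beta (w1 + a * tau) (- (w2 + b * tau)) + tau *: beta_adm TypeI k1 k2)%W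
  with (beta (w1 + (k1 + a) * tau) (- (w2 + (k1 + k2 + b) * tau)))
  by (apply weight_eq; weight_simpl; field).
rewrite num_L_add; [| assumption .. | apply IZR_lt in HM; destruct tau; cbn in *; nra].
unfold Psi; rewrite <- (Cmult_assoc (phase s n)); f_equal.
rewrite !RtoC_plus; f_equal; [| f_equal; field; exact HMC].
unfold qpow; rewrite <- e2pi_plus; f_equal.
weight_simpl; field; exact HMC.
Qed.

(** * The N=4 specialization *)

(** The parameter tau/4 of the reduction equals a b tau + b w1 + a w2 for
    a = b = 1/2 and w1 + w2 = 0; after the twist it becomes z, which has the same
    form with (a, b) = (1, 0) or (0, 1). *)
Lemma num_untwisted_I (s : Defs.sign) (M m n k1 k2 : Z) (tau z : C) :
  (0 < M)%Z -> (0 < m)%Z -> (0 <= n)%Z -> (0 < Im tau)%R ->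
  num_ddotL_sector s Untwisted M m n TypeI k1 k2 tau
    (z + tau / 2) (z - tau / 2) (tau / 4)
  = phase s n
    * Psi M m (- n) (shift s) (k1 + 1 / 2) (k1 + k2 + 1 / 2) tau z (- z) 0.
Proof.
intros HM Hm Hn Ht; cbn [num_ddotL_sector].
rewrite <- num_ddotL_I_Psi by assumption.
f_equal; rewrite RtoC_div by lra; field.
Qed.

Lemma num_untwisted_III (s : Defs.sign) (M m n k1 k2 : Z) (tau z : C) :
  (0 < M)%Z -> (0 < m)%Z -> (0 <= n)%Z -> (0 < Im tau)%R ->
  num_ddotL_sector s Untwisted M m n TypeIII k1 k2 tau
    (z + tau / 2) (z - tau / 2) (tau / 4)
  = phase s n
    * Psi M m (- n) (shift s) (k1 + 1 / 2) (k1 + k2 + 1 / 2) tau (- z) z 0.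
Proof.
intros HM Hm Hn Ht; cbn [num_ddotL_sector].
rewrite num_ddotL_III, <- num_ddotL_I_Psi by assumption.
f_equal; rewrite RtoC_div by lra; field.
Qed.

Lemma num_twisted_I (s : Defs.sign) (M m n k1 k2 : Z) (tau z : C) :
  (0 < M)%Z -> (0 < m)%Z -> (0 <= n)%Z -> (0 < Im tau)%R ->
  num_ddotL_sector s Twisted M m n TypeI k1 k2 tau
    (z + tau / 2) (z - tau / 2) (tau / 4)
  = phase s n * Psi M m (- n) (shift s) (k1 + 1) (k1 + k2) tau (- z) z 0.
Proof.
intros HM Hm Hn Ht; cbn [num_ddotL_sector]; unfold twist.
replace (k1 + k2)%R with (k1 + k2 + 0)%R by ring.
rewrite <- num_ddotL_I_Psi by assumption.
f_equal; field.
Qed.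

Lemma num_twisted_III (s : Defs.sign) (M m n k1 k2 : Z) (tau z : C) :
  (0 < M)%Z -> (0 < m)%Z -> (0 <= n)%Z -> (0 < Im tau)%R ->
  num_ddotL_sector s Twisted M m n TypeIII k1 k2 tau
    (z + tau / 2) (z - tau / 2) (tau / 4)
  = phase s n * Psi M m (- n) (shift s) k1 (k1 + k2 + 1) tau z (- z) 0.
Proof.
intros HM Hm Hn Ht; cbn [num_ddotL_sector]; unfold twist.
replace (Psi M m (- n) (shift s) k1) with (Psi M m (- n) (shift s) (k1 + 0))
  by (f_equal; ring).
rewrite num_ddotL_III, <- num_ddotL_I_Psi by assumption.
f_equal; field.
Qed.

Definition N4_theta (s : Defs.sign) (sec : sector) : C -> C -> C :=
  match s, sec with
  | SPlus, Untwisted => theta 0 0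
  | SMinus, Untwisted => theta 0 1
  | SPlus, Twisted => theta 1 0
  | SMinus, Twisted => theta 1 1
  end.

Lemma N4_ch_numerator (s : Defs.sign) (sec : sector) (M m n : Z) (ty : heart)
    (k1 k2 : Z) (tau z : C) :
  N4_ch s sec M m n ty k1 k2 tau z
  = sgn s * Ci
    * num_ddotL_sector s sec M m n ty k1 k2 tau (z + tau / 2) (z - tau / 2) (tau / 4)
    * (N4_theta s sec tau z ^ 2 / (eta tau ^ 3 * theta 1 1 tau (2 * z))).
Proof.
assert (HC : Ci <> 0) by (intros E; apply (f_equal snd) in E; cbn in E; lra).
assert (HC' : - Ci <> 0)
  by (intros E; apply HC; replace Ci with (- - Ci) by ring; rewrite E; ring).
assert (HI : / - Ci = Ci) by (rewrite <- Ci_inv; field; exact HC).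
unfold N4_ch, N4_denominator; destruct s, sec; cbn [N4_theta sgn];
  rewrite Cdiv_mult_div, ?HI, ?Ci_inv by assumption; ring.
Qed.

Theorem proposition5p2 (M m m2 : Z)
    (hM : (0 < M)%Z) (hm : (0 < m)%Z) (hMm : Z.gcd M m = 1%Z)
    (hm2 : (0 <= m2 <= m - 1)%Z) :
  ((forall k1 k2 : Z, Omega TypeI M k1 k2 ->
      mero_eq (N4_ch SPlus Untwisted M m m2 TypeI k1 k2)
        (fun tau z =>
           Ci * powerRZ (-1) m2
           * Psi M m (- m2) (1 / 2) (k1 + 1 / 2) (k1 + k2 + 1 / 2) tau z (- z) 0
           * (theta 0 0 tau z ^ 2 / (eta tau ^ 3 * theta 1 1 tau (2 * z)))))
   /\
   (forall k1 k2 : Z, Omega TypeIII M k1 k2 ->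
      mero_eq (N4_ch SPlus Untwisted M m m2 TypeIII k1 k2)
        (fun tau z =>
           Ci * powerRZ (-1) m2
           * Psi M m (- m2) (1 / 2) (k1 + 1 / 2) (k1 + k2 + 1 / 2) tau (- z) z 0
           * (theta 0 0 tau z ^ 2 / (eta tau ^ 3 * theta 1 1 tau (2 * z))))))
  /\
  ((forall k1 k2 : Z, Omega TypeI M k1 k2 ->
      mero_eq (N4_ch SMinus Untwisted M m m2 TypeI k1 k2)
        (fun tau z =>
           Ci
           * Psi M m (- m2) 0 (k1 + 1 / 2) (k1 + k2 + 1 / 2) tau z (- z) 0
           * (theta 0 1 tau z ^ 2 / (eta tau ^ 3 * theta 1 1 tau (2 * z)))))
   /\
   (forall k1 k2 : Z, Omega TypeIII M k1 k2 ->
      mero_eq (N4_ch SMinus Untwisted M m m2 TypeIII k1 k2)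
        (fun tau z =>
           Ci
           * Psi M m (- m2) 0 (k1 + 1 / 2) (k1 + k2 + 1 / 2) tau (- z) z 0
           * (theta 0 1 tau z ^ 2 / (eta tau ^ 3 * theta 1 1 tau (2 * z))))))
  /\
  ((forall k1 k2 : Z, Omega TypeI M k1 k2 ->
      mero_eq (N4_ch SPlus Twisted M m m2 TypeI k1 k2)
        (fun tau z =>
           Ci * powerRZ (-1) m2
           * Psi M m (- m2) (1 / 2) (k1 + 1) (k1 + k2) tau (- z) z 0
           * (theta 1 0 tau z ^ 2 / (eta tau ^ 3 * theta 1 1 tau (2 * z)))))
   /\
   (forall k1 k2 : Z, Omega TypeIII M k1 k2 ->
      mero_eq (N4_ch SPlus Twisted M m m2 TypeIII k1 k2)
        (fun tau z =>
           Ci * powerRZ (-1) m2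
           * Psi M m (- m2) (1 / 2) k1 (k1 + k2 + 1) tau z (- z) 0
           * (theta 1 0 tau z ^ 2 / (eta tau ^ 3 * theta 1 1 tau (2 * z))))))
  /\
  ((forall k1 k2 : Z, Omega TypeI M k1 k2 ->
      mero_eq (N4_ch SMinus Twisted M m m2 TypeI k1 k2)
        (fun tau z =>
           Ci
           * Psi M m (- m2) 0 (k1 + 1) (k1 + k2) tau (- z) z 0
           * (theta 1 1 tau z ^ 2 / (eta tau ^ 3 * theta 1 1 tau (2 * z)))))
   /\
   (forall k1 k2 : Z, Omega TypeIII M k1 k2 ->
      mero_eq (N4_ch SMinus Twisted M m m2 TypeIII k1 k2)
        (fun tau z =>
           Ci
           * Psi M m (- m2) 0 k1 (k1 + k2 + 1) tau z (- z) 0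
           * (theta 1 1 tau z ^ 2 / (eta tau ^ 3 * theta 1 1 tau (2 * z)))))).
Proof.
assert (Hn : (0 <= m2)%Z) by lia.
repeat split; intros k1 k2 _ tau z Ht _; rewrite N4_ch_numerator;
  [ rewrite num_untwisted_I | rewrite num_untwisted_III
  | rewrite num_untwisted_I | rewrite num_untwisted_III
  | rewrite num_twisted_I | rewrite num_twisted_III
  | rewrite num_twisted_I | rewrite num_twisted_III ];
  try assumption; cbn [N4_theta sgn phase shift]; ring.
Qed.
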